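(* Let $k\ge 1$ be an integer, let $G_k=G(k+(k+1)i)$ be the dense Gaussian network, and let $d$ denote its graph distance. Let $F_1$ and $F_2$ be any two nodes of $G_k$. Then there exists a node $NS$ of $G_k$ such that $d(F_1,NS)=k$ and $d(F_2,NS)=k$.
   Context: For an integer $k\ge 1$ put $\pi=k+(k+1)i\in\mathbb{Z}[i]$. The dense Gaussian network $G_k=G(\pi)$ is the undirected graph whose vertex (node) set is the set of residue classes $\mathbb{Z}[i]_\pi=\mathbb{Z}[i]/(\pi)$, and in which two vertices $\alpha,\beta$ are adjacent if and only if $\beta-\alpha\equiv \pm1$ or $\pm i \pmod \pi$. It has $N=k^2+(k+1)^2=2k^2+2k+1$ nodes. The distance $d(u,v)$ is the graph distance, i.e. the minimum number of edges on a path joining $u$ and $v$; the diameter of $G_k$ is $k$. *)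

(* Defs.v *)
From HB Require Import structures.
From mathcomp Require Import all_boot all_order all_algebra.
From mathcomp Require Import boolp complex ring.

Set Implicit Arguments.
Unset Strict Implicit.
Unset Printing Implicit Defensive.

Import GRing.Theory.
Local Open Scope ring_scope.
Local Open Scope complex_scope.
Local Open Scope quotient_scope.

(* The ring Z[i]. The library gives [complex int] its additive group but makes
   [complex R] a ring only when R is a field, hence the alias. *)
Definition gauss_int := complex int.

HB.instance Definition _ := GRing.Zmodule.on gauss_int.

Lemma gauss_mul1 : left_id ((1 +i* 0) : gauss_int) (@ComplexField.mulc int).
Proof. by move=> [a b] /=; rewrite !mul1r !mul0r subr0 addr0. Qed.

Lemma gauss_mulDl :
  left_distributive (@ComplexField.mulc int) (+%R : gauss_int -> _ -> _).
Proof.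
by move=> [a b] [c d] [e f]; congr (_ +i* _); rewrite /=; ring.
Qed.

Lemma gauss_1neq0 : ((1 +i* 0) : gauss_int) != 0.
Proof. by []. Qed.

HB.instance Definition _ := GRing.Zmodule_isComNzRing.Build gauss_int
  (@ComplexField.mulcA int) (@ComplexField.mulcC int)
  gauss_mul1 gauss_mulDl gauss_1neq0.

Definition gauss_i : gauss_int := 0 +i* 1.

Definition gauss_pi (k : nat) : gauss_int := k%:R + k.+1%:R * gauss_i.

Lemma gauss_piE k : gauss_pi k = k%:Z +i* k.+1%:Z.
Proof.
have natE n : (n%:R : gauss_int) = n%:Z +i* 0.
  by elim: n => // n IHn; rewrite -addn1 natrD IHn PoszD.
rewrite /gauss_pi !natE /gauss_i.
by congr (_ +i* _) => /=; ring.
Qed.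

Section PrincipalIdeal.
Variable a : gauss_int.

Definition gauss_ideal : {pred gauss_int} :=
  fun z => `[< exists q : gauss_int, z = q * a >].

Lemma gauss_idealP z :
  reflect (exists q : gauss_int, z = q * a) (z \in gauss_ideal).
Proof. exact: asboolP. Qed.

Lemma gauss_ideal_zmod_closed : zmod_closed gauss_ideal.
Proof.
split=> [|x y /gauss_idealP[q ->] /gauss_idealP[r ->]].
  by apply/gauss_idealP; exists 0; rewrite mul0r.
by apply/gauss_idealP; exists (q - r); rewrite mulrBl.
Qed.

HB.instance Definition _ :=
  GRing.isZmodClosed.Build gauss_int gauss_ideal gauss_ideal_zmod_closed.

End PrincipalIdeal.

(* Only the additive structure of Z[i]/(pi) is needed. Taking the quotient of
   additive groups covers k = 0, where pi is a unit and the library's quotient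
   by a proper ideal is unavailable. *)
Definition gnode (k : nat) := {ideal_quot (gauss_ideal (gauss_pi k))}.

HB.instance Definition _ k := GRing.Zmodule.on (gnode k).

Definition residue (k : nat) (z : gauss_int) : gnode k :=
  \pi_({ideal_quot (gauss_ideal (gauss_pi k))}) z.

(* Finiteness: a class is determined by the coordinates of any representative
   modulo N = k^2 + (k+1)^2, since N lies in the ideal (pi). *)
Section Finiteness.
Variable k : nat.
Local Notation N := (k ^ 2 + k.+1 ^ 2)%N.

Definition gnode_code (u : gnode k) : 'I_N.-1.+1 * 'I_N.-1.+1 :=
  let z : gauss_int := repr u in
  (inord `|(Re z %% N%:Z)%Z|%N, inord `|(Im z %% N%:Z)%Z|%N).

Definition gnode_decode (p : 'I_N.-1.+1 * 'I_N.-1.+1) : gnode k :=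
  residue k ((p.1 : nat)%:Z +i* (p.2 : nat)%:Z).

Lemma gnode_codeK : cancel gnode_code gnode_decode.
Proof.
move=> u; rewrite -[RHS]reprK; case Ez: (repr u) => [a b].
rewrite /gnode_decode /gnode_code Ez /=.
have N0 : (0 < N)%N by rewrite addn_gt0 orbC expn_gt0.
have NZ0 : (N%:Z : int) != 0 by case: (N) N0.
have modE (c : int) :
    ((inord `|(c %% N%:Z)%Z|%N : 'I_N.-1.+1) : nat)%:Z = (c %% N%:Z)%Z.
  rewrite inordK ?gez0_abs ?modz_ge0 //.
  by rewrite prednK // -ltz_nat gez0_abs ?modz_ge0 // ltz_pmod.
rewrite !modE /residue; apply/eqP; rewrite -Quotient.idealrBE.
apply/gauss_idealP.
exists (- (((a %/ N%:Z)%Z +i* (b %/ N%:Z)%Z : gauss_int)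
           * ((k%:Z +i* - (k.+1%:Z)) : gauss_int))).
rewrite gauss_piE {2}(divz_eq a N) {2}(divz_eq b N).
set qa := (a %/ _)%Z; set qb := (b %/ _)%Z.
set ra := (a %% _)%Z; set rb := (b %% _)%Z.
have -> : N%:Z = k%:Z ^+ 2 + (k.+1)%:Z ^+ 2 by rewrite PoszD -!mulnn !PoszM -!expr2.
by congr (_ +i* _) => /=; ring.
Qed.

End Finiteness.

HB.instance Definition _ k : isCountable (gnode k) :=
  CanIsCountable (@gnode_codeK k).

HB.instance Definition _ k : isFinite (gnode k) :=
  CanIsFinite (@gnode_codeK k).

Definition gadj (k : nat) : rel (gnode k) :=
  fun u v => (v - u) \in
    [:: residue k 1; residue k (- 1); residue k gauss_i; residue k (- gauss_i)].

Lemma gadj_sym k : symmetric (@gadj k).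
Proof.
have resN z : residue k (- z) = - residue k z by exact: Quotient.pi_opp.
suff H : forall u v, @gadj k u v -> @gadj k v u.
  by move=> u v; apply/idP/idP; apply: H.
move=> u v; rewrite /gadj !inE !resN -(opprB v u).
by case/or4P=> /eqP ->; rewrite ?opprK !eqxx ?orbT.
Qed.

(* The minimum of n over all paths from x to y with n edges (x :: p lists the
   n + 1 distinct vertices of a path); #|T|, which exceeds the length of any
   path, if there is none. *)
Definition gdist (T : finType) (e : rel T) (x y : T) : nat :=
  \big[minn/#|T|]_(n < #|T| | [exists p : n.-tuple T,
     [&& path e x p, uniq (x :: p) & last x p == y]]) n.

(* Main.v *)
Require Import Defs.
From mathcomp Require Import all_boot all_order all_algebra.
From mathcomp Require Import complex ring zify.

(** In the taxicab norm on Z[i], nonzero multiples of pi have norm at least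
    2k + 1; hence the class of z lies at distance |z| from 0 as soon as
    |z| <= k, and two nodes differing by the class of w have a common node at
    distance k from both whenever the spheres of radius k around 0 and w meet.
    In the coordinates (x + y, x - y) these spheres are boundaries of squares,
    and their lattice points meet if both coordinates of w are even and at most
    2k in absolute value. Rounding z / pi makes them at most k + 1, and
    subtracting +pi or -pi makes them even when they are odd, because
    the real and imaginary parts of pi have odd sum. *)

Set Implicit Arguments.
Unset Strict Implicit.
Unset Printing Implicit Defensive.

Import GRing.Theory Num.Theory.

(** * Graph distance as the least length of a walk *)

Lemma bigmin_le (I : eqType) (r : seq I) (P : pred I) (F : I -> nat) idx i :
  i \in r -> P i -> (\big[minn/idx]_(j <- r | P j) F j <= F i)%N.
Proof.
elim: r => // j r IH; rewrite inE big_cons => /orP[/eqP <- -> | ir Pi].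
  exact: geq_minl.
by case: (P j); [apply: (leq_trans (geq_minr _ _)) |]; exact: IH.
Qed.

(** Minimality of [p] is among all walks, whereas [gdist] ranges over simple paths; removing the
    loops of [p] cannot lengthen it, hence keeps its length. *)
Lemma gdist_eq (T : finType) (e : rel T) (x y : T) (p : seq T) :
  path e x p -> last x p = y ->
  (forall q, path e x q -> last x q = y -> size p <= size q)%N ->
  gdist e x y = size p.
Proof.
move=> ep + minp; set m := size p; case/shortenP: ep => p' ep' up' sp' p'y.
have szp' : size p' = m.
  apply/eqP; rewrite eqn_leq minp ?andbT //.
  by case/andP: up' => _ up'; apply: uniq_leq_size up' sp'.
have ltmT : (m < #|T|)%N.
  by rewrite -szp' -[X in (X <= _)%N]/(size (x :: p')) -(card_uniqP up') max_card.
apply/eqP; rewrite eqn_leq; apply/andP; split.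
  apply: (@bigmin_le _ _ _ (@nat_of_ord _) _ (Ordinal ltmT)).
    exact: mem_index_enum.
  have tp' : size p' == m by rewrite szp'.
  by apply/existsP; exists (Tuple tp'); rewrite ep' up' -p'y eqxx.
rewrite /gdist; elim/big_ind: _ => [|a b ma mb|i /existsP[q /and3P[eq _ /eqP qy]]].
- exact: ltnW.
- by rewrite leq_min ma mb.
- by rewrite -(size_tuple q); apply: minp.
Qed.

Local Open Scope ring_scope.
Local Open Scope complex_scope.

(** * Distances read off from the taxicab norm *)

Definition l1norm (z : gauss_int) : nat := (`|complex.Re z| + `|complex.Im z|)%N.

Lemma residueD k z w : residue k (z + w) = residue k z + residue k w.
Proof. exact: Quotient.pi_add. Qed.

Lemma residueB k z w : residue k (z - w) = residue k z - residue k w.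
Proof. by rewrite residueD; congr (_ + _); apply: Quotient.pi_opp. Qed.

Lemma residue0 k : residue k 0 = 0.
Proof. by apply: (addrI (residue k 0)); rewrite -residueD !addr0. Qed.

Lemma residue_repr k (u : gnode k) : residue k (repr u) = u.
Proof. exact: reprK. Qed.

Lemma residue_eq0 k z :
  residue k z = 0 <-> exists q : gauss_int, z = q * gauss_pi k.
Proof.
rewrite -[X in _ = X](residue0 k); split=> [/eqP|h]; last apply/eqP.
  by rewrite -Quotient.idealrBE subr0 => /gauss_idealP.
by rewrite -Quotient.idealrBE subr0; apply/gauss_idealP.
Qed.

Lemma residue_subM k z q : residue k (z - q * gauss_pi k) = residue k z.
Proof.
rewrite residueB [X in _ - X](_ : _ = 0) ?subr0 //.
by apply/residue_eq0; exists q.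
Qed.

Lemma gauss_mul_piE k c d :
  (c +i* d : gauss_int) * gauss_pi k =
  (c * k%:Z - d * k.+1%:Z) +i* (c * k.+1%:Z + d * k%:Z).
Proof. by rewrite gauss_piE. Qed.

Lemma l1norm_unit (e : gauss_int) :
  e \in [:: 1; - 1; gauss_i; - gauss_i] -> l1norm e = 1%N.
Proof. by rewrite !inE => /or4P[] /eqP ->. Qed.

Lemma l1normD z w : (l1norm (z + w)%R <= l1norm z + l1norm w)%N.
Proof. by case: z w => [a b] [c d]; rewrite /l1norm /=; lia. Qed.

Lemma gadjP k (u v : gnode k) :
  reflect (exists2 e, e \in [:: 1; - 1; gauss_i; - gauss_i]
                      & v = u + residue k e)
          (gadj u v).
Proof.
rewrite /gadj; apply: (iffP idP) => [|[e he ->]].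
  by rewrite !inE => /or4P[] /eqP h;
    [exists 1|exists (-1)|exists gauss_i|exists (- gauss_i)];
    rewrite ?inE ?eqxx ?orbT // -h addrC subrK.
rewrite addrC addKr.
by move: he; rewrite !inE => /or4P[] /eqP ->; rewrite eqxx ?orbT.
Qed.

(** Each edge lifts to a unit of Z[i], and [z] is the sum of these lifts. *)
Lemma gpath_l1norm k (u : gnode k) p :
  path (@gadj k) u p ->
  exists2 z, last u p = u + residue k z & (l1norm z <= size p)%N.
Proof.
elim: p u => [|v p IH] u /=.
  by exists 0 => //; rewrite residue0 addr0.
case/andP=> /gadjP[e he ->] /IH[z -> hz].
exists (e + z); first by rewrite residueD addrA.
by rewrite (leq_trans (l1normD _ _)) // (l1norm_unit he).
Qed.

Lemma l1norm_step (z : gauss_int) n : l1norm z = n.+1 ->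
  exists2 e, e \in [:: 1; - 1; gauss_i; - gauss_i] & l1norm (z - e) = n.
Proof.
case: z => a b; rewrite /l1norm /= => h.
have [a0|a0|a0] := ltrgtP a 0.
- by exists (- 1) => //=; lia.
- by exists 1 => //=; lia.
have [b0|b0|b0] := ltrgtP b 0; last lia.
- by exists (- gauss_i) => //=; lia.
- by exists gauss_i => //=; lia.
Qed.

Lemma l1norm_gpath k (u : gnode k) z :
  exists p, [/\ path (@gadj k) u p, last u p = u + residue k z
              & size p = l1norm z].
Proof.
move: {-2}(l1norm z) (erefl (l1norm z)) => n.
elim: n z u => [|n IH] z u hz.
  exists [::]; split=> //=; suff -> : z = 0.
    by rewrite residue0 addr0.
  case: z hz => a b; rewrite /l1norm /= => hz.
  by have [-> ->] : a = 0 /\ b = 0 by lia.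
have [e he /esym/(IH _ (u + residue k e))[p [pp lp sp]]] :=
  l1norm_step (esym hz).
exists (u + residue k e :: p); split=> /=; last by rewrite sp.
  by rewrite pp andbT; apply/gadjP; exists e.
by rewrite lp residueB addrCA addrA addrA addrK addrC.
Qed.

(** The norm of x + yi is the larger of |x + y| and |x - y|. For [q] = c + di these are |(2k+1)c -
    d| and |(2k+1)d + c|: the second is large if cd > 0, the first if cd < 0 or d = 0, the second
    again if c = 0. *)
Lemma l1norm_ideal k (q : gauss_int) :
  q != 0 -> (k.*2 < l1norm (q * gauss_pi k)%R)%N.
Proof.
case: q => c d q0; rewrite gauss_mul_piE /l1norm /=.
have {q0} : c != 0 \/ d != 0.
  by apply/orP; rewrite -negb_and; apply: contra q0 => /andP[/eqP -> /eqP ->].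
nia.
Qed.

(** A shorter walk would lift to some [w] in the class of [z] with |w| < |z| <= k, making [w - z] a
    nonzero multiple of pi of norm below 2k. *)
Lemma gdist_small k (u : gnode k) z :
  (l1norm z <= k)%N -> gdist (@gadj k) u (u + residue k z) = l1norm z.
Proof.
move=> hz; have [p [pp lp sp]] := l1norm_gpath u z.
rewrite -sp; apply: gdist_eq => // q /gpath_l1norm[w -> hw] /addrI wz.
rewrite sp leqNgt; apply/negP => ltq.
have /residue_eq0[r hr] : residue k (w - z) = 0 by rewrite residueB wz subrr.
have [r0|/(l1norm_ideal k)] := eqVneq r 0.
  move: hr; rewrite r0 mul0r => /eqP; rewrite subr_eq0 => /eqP wzE.
  by move: hw; rewrite wzE leqNgt ltq.
rewrite -hr => /leq_trans/(_ (l1normD w (- z))).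
have -> : l1norm (- z) = l1norm z by case: (z) => a b; rewrite /l1norm /=; lia.
by have := leq_ltn_trans hw ltq; lia.
Qed.

(** * Representatives with small even coordinates *)

Lemma round_div (x n : int) : 0 < n ->
  exists c, - n <= 2 * (x - c * n) <= n.
Proof.
(* The floor of x/n + 1/2 is an integer nearest to x/n. *)
move=> n0; exists ((2 * x + n) %/ (2 * n))%Z.
have := divz_eq (2 * x + n) (2 * n).
have := modz_ge0 (2 * x + n) (d := 2 * n).
have := ltz_pmod (2 * x + n) (d := 2 * n).
set q := divz _ _; set r := modz _ _ => h1 h2 h3.
have {}h1 : r < 2 * n by apply: h1; lia.
have {}h2 : 0 <= r by apply: h2; lia.
lia.
Qed.

(* Rounding z / pi leaves z - q pi = (r + r' i) pi / N with |r|, |r'| <= N/2. *)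
Lemma residue_near k z : exists2 w : gauss_int, residue k w = residue k z &
  (`|(complex.Re w + complex.Im w)%R| <= k.+1)%N /\
  (`|(complex.Re w - complex.Im w)%R| <= k.+1)%N.
Proof.
case: z => a b; set K := k%:Z.
pose N := K ^+ 2 + (K + 1) ^+ 2.
have N0 : 0 < N by rewrite /N; nia.
(* The numerators are the coordinates of [z] times the conjugate of pi, and [N] is the norm of
   pi. *)
have [c hc] := round_div (a * K + b * (K + 1)) N0.
have [d hd] := round_div (b * K - a * (K + 1)) N0.
exists ((a +i* b : gauss_int) - (c +i* d : gauss_int) * gauss_pi k).
  exact: residue_subM.
rewrite gauss_mul_piE /=.
have -> : k.+1%:Z = K + 1 by rewrite /K; lia.
rewrite -/K.
set r := _ - c * N in hc; set r' := _ - d * N in hd.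
set x := a - _; set y := b - _.
have hs : N * (x + y) = (2 * K + 1) * r - r' by rewrite /x /y /r /r' /N; ring.
have ht : N * (x - y) = - r - (2 * K + 1) * r' by rewrite /x /y /r /r' /N; ring.
have K0 : 0 <= K by [].
have bound (s : int) :
    - (N * (K + 1)) <= N * s <= N * (K + 1) -> (`|s| <= k.+1)%N.
  rewrite -mulrN !ler_pM2l // => h; lia.
clearbody r r' x y N.
split; apply: bound; nia.
Qed.

Lemma residue_even k z : (0 < k)%N ->
  exists s t : int, exists2 w : gauss_int, residue k w = residue k z &
  [/\ w = (s + t) +i* (s - t), (`|s| <= k)%N & (`|t| <= k)%N].
Proof.
move=> k0; have [[x y] <- /= [hs ht]] := residue_near k z.
have [h|[h|h]] : (exists s, x + y = 2 * s) \/
    (exists s, x + y = 2 * s + 1 /\ 0 < x + y) \/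
    (exists s, x + y = 2 * s + 1 /\ x + y < 0).
- have := divz_eq (x + y) 2; have := modz_ge0 (x + y) (d := 2) isT.
  have := ltz_pmod (x + y) (d := 2) isT.
  set q := divz _ _; set r := modz _ _ => h1 h2 h3.
  have [r0|r0] : r = 0 \/ r = 1 by lia.
    by left; exists q; lia.
  have [?|?] : 0 < x + y \/ x + y < 0 by lia.
    by right; left; exists q; lia.
  by right; right; exists q; lia.
- case: h => s h; exists s, (x - s), (x +i* y) => //.
  by split; [congr (_ +i* _); lia | lia | lia].
(* Subtracting pi moves x + y from [1, k+1] into [-2k, -k] and x - y to x - y + 1, which is even and
   at most k + 2 in absolute value, hence at most 2k even for k = 1. The last case mirrors this. *)
- case: h => s [h xy0]; exists (s - k%:Z), (x - s).
  exists ((x +i* y : gauss_int) - (1 +i* 0 : gauss_int) * gauss_pi k).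
    exact: residue_subM.
  rewrite gauss_mul_piE.
  by split; [congr (_ +i* _) => /=; lia | lia | lia].
- case: h => s [h xy0]; exists (s + k%:Z + 1), (x - s - 1).
  exists ((x +i* y : gauss_int) - (-1 +i* 0 : gauss_int) * gauss_pi k).
    exact: residue_subM.
  rewrite gauss_mul_piE.
  by split; [congr (_ +i* _) => /=; lia | lia | lia].
Qed.

(** In the coordinates (x + y, x - y) the second centre is (2s, 2t). The witness has first
    coordinate k or -k, with the sign of s, and second coordinate 2t - k if t >= 0, 2t + k
    otherwise: the first puts it on the sphere around 0, the second on the other. *)
Lemma l1sphere_meet k (s t : int) : (`|s| <= k)%N -> (`|t| <= k)%N ->
  exists2 z : gauss_int, l1norm z = k &
    l1norm (z - ((s + t) +i* (s - t) : gauss_int)) = k.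
Proof.
move=> hs ht.
have [s0|s0] := lerP 0 s; have [t0|t0] := lerP 0 t.
- by exists (t +i* (k%:Z - t)); rewrite /l1norm /=; lia.
- by exists ((k%:Z + t) +i* (- t)); rewrite /l1norm /=; lia.
- by exists ((t - k%:Z) +i* (- t)); rewrite /l1norm /=; lia.
- by exists (t +i* (- k%:Z - t)); rewrite /l1norm /=; lia.
Qed.

Theorem theorem1 (k : nat) (hk : (1 <= k)%N) (F1 F2 : gnode k) :
  exists NS : gnode k,
    gdist (@gadj k) F1 NS = k /\ gdist (@gadj k) F2 NS = k.
Proof.
have [s [t [w ww [wE hs ht]]]] := residue_even (repr (F2 - F1)) hk.
have [z hz hzw] := l1sphere_meet hs ht; rewrite -wE in hzw.
exists (F1 + residue k z); split; first by rewrite gdist_small hz.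
have -> : F1 + residue k z = F2 + residue k (z - w).
  by rewrite residueB ww residue_repr opprB addrCA [F2 + _]addrC subrK addrC.
by rewrite gdist_small hzw.
Qed.
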